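(* Any tensor field $f\in C_c^2(S^2;D_1)$ can be recovered from $\mathcal{L}f$, $\mathcal{L}^1f$ and $\mathcal{M}f$; that is, if $f,\tilde f\in C_c^2(S^2;D_1)$ satisfy $\mathcal{L}f=\mathcal{L}\tilde f$, $\mathcal{L}^1f=\mathcal{L}^1\tilde f$ and $\mathcal{M}f=\mathcal{M}\tilde f$ on $\mathbb{R}^2$, then $f=\tilde f$.
   Context: $D_1\subset\mathbb{R}^2$ is an open disc of radius $r_1>0$ centered at the origin. $C_c^2(S^2;D_1)$ is the space of symmetric $2$-tensor fields $f=(f_{ij})_{i,j=1,2}$, $f_{12}=f_{21}$, whose components are twice continuously differentiable and compactly supported in $D_1$ (extended by zero to $\mathbb{R}^2$). For symmetric $2$-tensors, $\langle f,g\rangle=f_{11}g_{11}+2f_{12}g_{12}+f_{22}g_{22}$. For vectors $a,b\in\mathbb{R}^2$, $(a\odot b)_{ij}=\frac12(a_ib_j+a_jb_i)$, $a^2=a\odot a$, and $a^\perp=(-a_2,a_1)$. For a unit vector $a$, an integer $k\ge0$ and a compactly supported function $h$, $\mathcal{X}^k_a h(x)=\int_0^\infty h(x+ta)\,t^k\,dt$ and $\mathcal{X}_a=\mathcal{X}^0_a$. Fix unit vectors $u=(u_1,u_2)$ and $v=(-u_1,u_2)$ that are linearly independent (so $u_1u_2\neq0$, i.e. $-1<u_1^2-u_2^2<1$). Define the functions on $\mathbb{R}^2$ $$\mathcal{L}f=\mathcal{X}_u\langle f,u^2\rangle+\mathcal{X}_v\langle f,v^2\rangle,\quad \mathcal{L}^1f=\mathcal{X}^1_u\langle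 f,u^2\rangle+\mathcal{X}^1_v\langle f,v^2\rangle,\quad \mathcal{M}f=\mathcal{X}_u\langle f,u\odot u^\perp\rangle+\mathcal{X}_v\langle f,v\odot v^\perp\rangle$$ (longitudinal, first moment longitudinal and mixed V-line transforms). (Their values on a sufficiently large closed disc centered at the origin determine them on all of $\mathbb{R}^2$.) *)

(* Defs.v *)
(* Stdlib reals with Coquelicot. *)
From Stdlib Require Import Reals List.
From Coquelicot Require Import Coquelicot.
Open Scope R_scope.

Definition vec : Type := (R * R)%type.

Definition enorm (a : vec) : R := sqrt (fst a ^ 2 + snd a ^ 2).

Definition perp (a : vec) : vec := (- snd a, fst a).

Definition lin_indep (a b : vec) : Prop :=
  forall s t : R,
    s * fst a + t * fst b = 0 -> s * snd a + t * snd b = 0 -> s = 0 /\ t = 0.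

Definition disc (r : R) (x : vec) : Prop := enorm x < r.

(* The uniform structure on R * R is the sup-metric one; it induces the usual
   topology of the plane, which is all that the next three notions use. *)
Definition closure {T : UniformSpace} (S : T -> Prop) (x : T) : Prop :=
  forall eps : posreal, exists y, ball x eps y /\ S y.

Definition is_compact {T : UniformSpace} (K : T -> Prop) : Prop :=
  forall (I : Type) (U : I -> T -> Prop),
    (forall i, open (U i)) ->
    (forall x, K x -> exists i, U i x) ->
    exists l : list I, forall x, K x -> exists i, In i l /\ U i x.

Definition supp (h : vec -> R) : vec -> Prop := closure (fun x => h x <> 0).

(* [ex_diff_n _ 2] at every point: all partial derivatives of order at most 2
   exist and are continuous on the plane. *)
Definition Cc2 (r : R) (h : vec -> R) : Prop :=
  (forall x y : R, ex_diff_n (fun x' y' => h (x', y')) 2 x y) /\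
  is_compact (supp h) /\
  (forall x, supp h x -> disc r x).

Record tensor2 : Type := Tensor2 { c11 : R; c12 : R; c21 : R; c22 : R }.

Definition Cc2_sym (r : R) (f : vec -> tensor2) : Prop :=
  (forall x, c12 (f x) = c21 (f x)) /\
  Cc2 r (fun x => c11 (f x)) /\ Cc2 r (fun x => c12 (f x)) /\
  Cc2 r (fun x => c21 (f x)) /\ Cc2 r (fun x => c22 (f x)).

(* Only meant for symmetric arguments. *)
Definition tdot (f g : tensor2) : R :=
  c11 f * c11 g + 2 * (c12 f * c12 g) + c22 f * c22 g.

Definition odot (a b : vec) : tensor2 :=
  {| c11 := (fst a * fst b + fst a * fst b) / 2;
     c12 := (fst a * snd b + snd a * fst b) / 2;
     c21 := (snd a * fst b + fst a * snd b) / 2;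
     c22 := (snd a * snd b + snd a * snd b) / 2 |}.

(* [RInt_gen] is total; for h continuous with compact support and a <> 0 the
   integral exists, so its value is the genuine improper integral. *)
Definition Xray (k : nat) (a : vec) (h : vec -> R) (x : vec) : R :=
  RInt_gen (fun t : R => h (fst x + t * fst a, snd x + t * snd a) * t ^ k)
    (at_point 0) (Rbar_locally p_infty).

Definition Lmom (k : nat) (u v : vec) (f : vec -> tensor2) (x : vec) : R :=
  Xray k u (fun y => tdot (f y) (odot u u)) x +
  Xray k v (fun y => tdot (f y) (odot v v)) x.

Definition Ltrans (u v : vec) (f : vec -> tensor2) : vec -> R := Lmom 0 u v f.

Definition L1trans (u v : vec) (f : vec -> tensor2) : vec -> R := Lmom 1 u v f.

Definition Mtrans (u v : vec) (f : vec -> tensor2) (x : vec) : R :=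
  Xray 0 u (fun y => tdot (f y) (odot u (perp u))) x +
  Xray 0 v (fun y => tdot (f y) (odot v (perp v))) x.

(* Main.v *)
Require Import Defs.
From Stdlib Require Import Reals Lra FunctionalExtensionality.
From Coquelicot Require Import Coquelicot.
Open Scope R_scope.

(** The components of the difference h of the two fields enter through
    F = <h, u^2>, G = <h, v^2>, P = <h, u (.) u^perp>, Q = <h, v (.) v^perp>,
    and all three transforms of h vanish.  Write D_a for the derivative in
    direction a; then D_a X_a = -1 and D_a X^1_a = -X_a.

    Put W = X^1_u F = -X^1_v G and A = X_u F = -X_v G.  Then W is a
    transform along u and also one along v, so D_u W = -A = D_v W, and hence
    the derivative of W in the direction u - v = (2 u_1, 0) is zero: W is
    constant on horizontal lines ([constant_on_lines]).  A ray from a point far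
    out on the side towards which u points never meets the support, so W
    vanishes somewhere on each horizontal line, therefore everywhere.
    Differentiating along u gives A = 0 and then F = 0, and G = 0 follows in the
    same way from A = -X_v G ([vline_moments_injective]).

    F = G = 0 means h_12 = 0 and h_11 u_1^2 + h_22 u_2^2 = 0.  For such h the
    mirror symmetry of u and v gives Q = -P, so X_u P = X_v P, and the same
    argument, one moment lower, with W = X_u P and A = P yields P = 0
    ([signed_vline_injective]).  As P = u_1 u_2 (h_22 - h_11), this means
    h_11 = h_22, and the relation between them makes both zero.

    The identity D_{u-v} W = D_u W - D_v W is not available from directional
    derivatives alone; continuity of A makes it true, and this is why
    continuity of X_u F is established ([everywhere_continuous_Xray0]). *)

(** * Lines and regularity in the plane *)

Definition along (x a : vec) (t : R) : vec := (fst x + t * fst a, snd x + t * snd a).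

(** Only the vertical strip |x_1| < r matters: the directions considered have a
    non-zero first coordinate, so rays along them leave it for good. *)
Definition strip_supported (r : R) (h : vec -> R) : Prop :=
  forall x, r <= Rabs (fst x) -> h x = 0.

Definition everywhere_continuous (h : vec -> R) : Prop :=
  forall x : R * R, continuous (h : R * R -> R) x.

Lemma along_0 x a : along x a 0 = x.
Proof. destruct x; unfold along; simpl; f_equal; ring. Qed.

Lemma along_add x a s t : along (along x a s) a t = along x a (s + t).
Proof. unfold along; simpl; f_equal; ring. Qed.

Lemma continuous_on_line h x a t :
  everywhere_continuous h -> continuous (fun s => h (along x a s)) t.
Proof.
  intros Hc.
  apply (continuous_comp_2 (fun s : R => fst x + s * fst a)
           (fun s : R => snd x + s * snd a) (fun p q : R => h (p, q))).
  - apply (ex_derive_continuous (fun s : R => fst x + s * fst a)). auto_derive. easy.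
  - apply (ex_derive_continuous (fun s : R => snd x + s * snd a)). auto_derive. easy.
  - apply (continuous_ext (fun p : R * R => h p)); [now intros []|].
    apply Hc.
Qed.

(** * Ray transforms restricted to a line *)

Lemma is_RInt_continuous (phi : R -> R) :
  (forall t, continuous phi t) -> forall a b, is_RInt phi a b (RInt phi a b).
Proof.
  intros Hc a b. apply (RInt_correct phi a b).
  apply (ex_RInt_continuous phi). intros; apply Hc.
Qed.

(** Substituting s + t for t turns the moment at parameter s into an integral
    over a bounded interval, on which s appears only in the weight and in the
    lower bound.  The case N < s is included: both sides are then zero. *)
Lemma is_RInt_gen_half_line (phi : R -> R) (k : nat) (s N : R) :
  (forall t, continuous phi t) -> (forall t, N <= t -> phi t = 0) ->
  is_RInt_gen (fun t => phi (s + t) * t ^ k) (at_point 0) (Rbar_locally p_infty)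
    (RInt (fun t => phi t * (t - s) ^ k) s N).
Proof.
  intros Hc H0.
  assert (HcF : forall t, continuous (fun t => phi t * (t - s) ^ k) t).
  { intros t. apply (continuous_mult phi (fun t => (t - s) ^ k)); [apply Hc|].
    apply (ex_derive_continuous (fun t => (t - s) ^ k)). auto_derive. easy. }
  apply (filterlimi_lim_ext_loc (fun ab => RInt (fun t => phi t * (t - s) ^ k) s N)).
  2: { intros P [e HP]. unfold filtermap. apply filter_forall. intros _.
       apply HP. apply ball_center. }
  (* The truncated integral does not depend on the upper bound b once b > N - s. *)
  apply Filter_prod with (Q := fun a => a = 0) (R := fun b => N - s < b).
  - now unfold at_point.
  - exists (N - s). now intros.
  - intros a b -> Hb. simpl.
    apply (is_RInt_ext (fun y => scal 1 ((fun t => phi t * (t - s) ^ k) (1 * y + s)))).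
    { intros y _. cbv beta. replace (1 * y + s) with (s + y) by ring.
      replace (s + y - s) with y by ring. apply Rmult_1_l. }
    apply (is_RInt_comp_lin (fun t => phi t * (t - s) ^ k) 1 s 0 b).
    replace (1 * 0 + s) with s by ring.
    assert (E : RInt (fun t => phi t * (t - s) ^ k) s N = RInt (fun t => phi t * (t - s) ^ k) s (1 * b + s)).
    { rewrite <- (RInt_Chasles _ s N (1 * b + s)); try (apply (ex_RInt_continuous (fun t => phi t * (t - s) ^ k)); intros; apply HcF).
      rewrite (RInt_ext _ (fun _ => 0) N).
      - rewrite RInt_const. symmetry. etransitivity; [|apply Rplus_0_r].
        apply Rplus_eq_compat_l, Rmult_0_r.
      - intros y Hy. rewrite Rmin_left in Hy by lra. rewrite H0; lra. }
    rewrite E.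
    apply (is_RInt_continuous _ HcF).
Qed.

(** Kept next to the equation for [Xray] because linearity of the total operator
    [RInt_gen] needs convergence. *)
Lemma is_RInt_gen_Xray k a h x s N :
  everywhere_continuous h -> (forall t, N <= t -> h (along x a t) = 0) ->
  is_RInt_gen (fun t => h (along (along x a s) a t) * t ^ k) (at_point 0) (Rbar_locally p_infty)
    (RInt (fun t => h (along x a t) * (t - s) ^ k) s N).
Proof.
  intros Hc H0.
  assert (E : (fun t => h (along (along x a s) a t) * t ^ k)
            = (fun t => h (along x a (s + t)) * t ^ k))
    by (apply functional_extensionality; intros t; now rewrite along_add).
  rewrite E.
  apply (is_RInt_gen_half_line (fun t => h (along x a t))); [|easy].
  intros t; now apply continuous_on_line.
Qed.

Lemma Xray_along k a h x s N :
  everywhere_continuous h -> (forall t, N <= t -> h (along x a t) = 0) ->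
  Xray k a h (along x a s) = RInt (fun t => h (along x a t) * (t - s) ^ k) s N.
Proof.
  intros Hc H0. apply is_RInt_gen_unique. now apply is_RInt_gen_Xray.
Qed.

Lemma is_derive_Xray0_along a h x s N :
  everywhere_continuous h -> (forall t, N <= t -> h (along x a t) = 0) ->
  is_derive (fun s => Xray 0 a h (along x a s)) s (- h (along x a s)).
Proof.
  intros Hc H0.
  apply (is_derive_ext (fun s => RInt (fun t => h (along x a t)) s N)).
  { intros t. rewrite (Xray_along 0 a h x t N Hc H0). apply RInt_ext.
    intros y _. simpl. ring. }
  apply (is_derive_RInt' (fun t => h (along x a t)) _ s N).
  - apply filter_forall. intros c. apply is_RInt_continuous.
    intros; now apply continuous_on_line.
  - now apply continuous_on_line.
Qed.

(** Expanding the weight t - s separates the two moments of h along the line, so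
    that only lower bounds of integrals depend on s; the boundary terms cancel. *)
Lemma is_derive_Xray1_along a h x s N :
  everywhere_continuous h -> (forall t, N <= t -> h (along x a t) = 0) ->
  is_derive (fun s => Xray 1 a h (along x a s)) s (- Xray 0 a h (along x a s)).
Proof.
  intros Hc H0.
  assert (Hphi : forall t, continuous (fun t => h (along x a t)) t)
    by (intros; now apply continuous_on_line).
  assert (Htphi : forall t, continuous (fun t => h (along x a t) * t) t).
  { intros t. apply (continuous_mult (fun t => h (along x a t)) (fun t => t));
      [apply Hphi|apply continuous_id]. }
  assert (I0 : forall c, is_RInt (fun t => h (along x a t)) c N
                           (RInt (fun t => h (along x a t)) c N))
    by (intros c; now apply is_RInt_continuous).
  assert (I1 : forall c, is_RInt (fun t => h (along x a t) * t) c N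
                           (RInt (fun t => h (along x a t) * t) c N))
    by (intros c; now apply is_RInt_continuous).
  apply (is_derive_ext (fun c => RInt (fun t => h (along x a t) * t) c N
                                 - c * RInt (fun t => h (along x a t)) c N)).
  { intros c. rewrite (Xray_along 1 a h x c N Hc H0). symmetry.
    apply is_RInt_unique.
    apply (is_RInt_ext (fun t => minus (h (along x a t) * t) (scal c (h (along x a t))))).
    { intros t _. unfold minus, plus, opp, scal; simpl; unfold mult; simpl. ring. }
    apply (is_RInt_minus (fun t => h (along x a t) * t) _ c N); [apply I1|].
    exact (is_RInt_scal (fun t => h (along x a t)) c N c _ (I0 c)). }
  rewrite (Xray_along 0 a h x s N Hc H0).
  rewrite (RInt_ext _ (fun t => h (along x a t))) by (intros; simpl; ring).
  evar_last.
  - apply (is_derive_minus (fun c => RInt (fun t => h (along x a t) * t) c N)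
             (fun c => c * RInt (fun t => h (along x a t)) c N)).
    + apply (is_derive_RInt' (fun t => h (along x a t) * t) _ s N); [|apply Htphi].
      apply filter_forall. exact I1.
    + apply (is_derive_mult (fun c => c) (fun c => RInt (fun t => h (along x a t)) c N)).
      * apply is_derive_id.
      * apply (is_derive_RInt' (fun t => h (along x a t)) _ s N); [|apply Hphi].
        apply filter_forall. exact I0.
      * intros; apply Rmult_comm.
  - unfold minus, plus, opp, mult, one; simpl. unfold mult, plus; simpl. ring.
Qed.

(** * Continuity and linearity of the ray transform *)

Lemma leaves_strip r x a t :
  fst a <> 0 -> (r + Rabs (fst x)) / Rabs (fst a) <= t -> r <= Rabs (fst (along x a t)).
Proof.
  intros Ha Ht. simpl.
  assert (Hp := Rabs_pos_lt _ Ha).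
  assert (r + Rabs (fst x) <= t * Rabs (fst a)).
  { apply (Rmult_le_compat_r (Rabs (fst a))) in Ht; [|lra].
    unfold Rdiv in Ht. rewrite Rmult_assoc, Rinv_l, Rmult_1_r in Ht; lra. }
  assert (H1 : t * Rabs (fst a) <= Rabs (t * fst a)).
  { rewrite Rabs_mult. apply Rmult_le_compat_r; [lra|apply Rle_abs]. }
  replace (fst x + t * fst a) with (t * fst a - - fst x) by ring.
  assert (H2 := Rabs_triang_inv (t * fst a) (- fst x)). rewrite Rabs_Ropp in H2. lra.
Qed.

Lemma everywhere_continuous_pt h :
  everywhere_continuous h <-> forall p q, continuity_2d_pt (fun x y => h (x, y)) p q.
Proof.
  split; intros H.
  - intros p q. apply continuity_2d_pt_filterlim.
    apply (continuous_ext (fun z : R * R => h z) (fun z => h (fst z, snd z))); [now intros []|].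
    apply H.
  - intros [p q]. apply (continuous_ext (fun z : R * R => h (fst z, snd z))); [now intros []|].
    exact (proj1 (continuity_2d_pt_filterlim (fun x y => h (x, y)) p q) (H p q)).
Qed.

Lemma coordinate_bound p q c t N :
  Rabs (p - q) < 1 -> 0 <= t <= N -> - (Rabs q + 1 + N * Rabs c) <= p + t * c <= Rabs q + 1 + N * Rabs c.
Proof.
  intros Hp Ht. apply Rabs_le_between.
  assert (Rabs (t * c) <= N * Rabs c).
  { rewrite Rabs_mult, (Rabs_pos_eq t) by lra. apply Rmult_le_compat_r; [apply Rabs_pos|lra]. }
  replace (p + t * c) with ((p - q) + q + t * c) by ring.
  assert (A1 := Rabs_triang (p - q + q) (t * c)).
  assert (A2 := Rabs_triang (p - q) q). lra.
Qed.

(** Near x all rays can be truncated at one common length N, after which they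
    stay in a fixed rectangle, where h is uniformly continuous. *)
Lemma everywhere_continuous_Xray0 r a h :
  0 < r -> fst a <> 0 -> everywhere_continuous h -> strip_supported r h ->
  everywhere_continuous (Xray 0 a h).
Proof.
  intros Hr Ha Hc Hs x.
  (* The extra 1 makes N valid for all points at distance less than 1 from x. *)
  set (N := (r + (Rabs (fst x) + 1)) / Rabs (fst a)).
  assert (Hp := Rabs_pos_lt _ Ha).
  assert (HN : 0 < N).
  { apply Rdiv_lt_0_compat; [|easy]. assert (H := Rabs_pos (fst x)). lra. }
  assert (E : forall y, Rabs (fst y - fst x) < 1 -> Xray 0 a h y = RInt (fun t => h (along y a t)) 0 N).
  { intros y Hy. rewrite <- (along_0 y a) at 1. rewrite (Xray_along 0 a h y 0 N Hc).
    - apply RInt_ext. intros; simpl; ring.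
    - intros t Ht. apply Hs, leaves_strip; [easy|]. apply Rle_trans with (2 := Ht).
      unfold N, Rdiv. apply Rmult_le_compat_r; [apply Rlt_le, Rinv_0_lt_compat; easy|].
      assert (A := Rabs_triang_inv (fst y) (fst x)). lra. }
  unfold continuous.
  apply (proj2 (filterlim_locally (U := R_UniformSpace) (F := locally (x : R * R)) _ _)).
  intros eps.
  set (M1 := Rabs (fst x) + 1 + N * Rabs (fst a)).
  set (M2 := Rabs (snd x) + 1 + N * Rabs (snd a)).
  (* The factor 2 makes the final bound eps / 2, hence strict. *)
  assert (He : 0 < eps / (2 * N)) by (apply Rdiv_lt_0_compat; [apply cond_pos|lra]).
  destruct (uniform_continuity_2d (fun p q => h (p, q)) (- M1) M1 (- M2) M2
              (fun p q _ _ => proj1 (everywhere_continuous_pt h) Hc p q) (mkposreal _ He))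
    as [d Hd].
  assert (Hm : 0 < Rmin d 1) by (apply Rmin_pos; [apply cond_pos|lra]).
  exists (mkposreal _ Hm). intros y [Hy1 Hy2].
  change (Rabs (@fst R R y - @fst R R x) < Rmin d 1) in Hy1.
  change (Rabs (@snd R R y - @snd R R x) < Rmin d 1) in Hy2.
  assert (A1 := Rmin_l d 1). assert (A2 := Rmin_r d 1).
  change (Rabs (Xray 0 a h y - Xray 0 a h x) < eps).
  rewrite (E y) by lra.
  rewrite (E x) by (rewrite Rminus_diag, Rabs_R0; lra).
  assert (Hex : forall z, ex_RInt (fun t => h (along z a t)) 0 N)
    by (intros z; eexists; apply is_RInt_continuous; intros; now apply continuous_on_line).
  pose proof (RInt_minus (fun t => h (along y a t)) (fun t => h (along x a t)) 0 N (Hex y) (Hex x)) as ED.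
  unfold minus at 2, plus, opp in ED; simpl in ED.
  unfold Rminus at 1. rewrite <- ED.
  apply Rle_lt_trans with ((N - 0) * (eps / (2 * N))).
  - apply abs_RInt_le_const; [lra|now apply (ex_RInt_minus (fun t => h (along y a t)))|].
    intros t Ht.
    apply Rlt_le, (Hd (fst x + t * fst a) (snd x + t * snd a) (fst y + t * fst a) (snd y + t * snd a)).
    + apply coordinate_bound; [rewrite Rminus_diag, Rabs_R0; lra|easy].
    + apply coordinate_bound; [rewrite Rminus_diag, Rabs_R0; lra|easy].
    + apply coordinate_bound; [exact (Rlt_le_trans _ _ _ Hy1 A2)|easy].
    + apply coordinate_bound; [exact (Rlt_le_trans _ _ _ Hy2 A2)|easy].
    + replace (fst y + t * fst a - (fst x + t * fst a)) with (fst y - fst x) by ring.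
      exact (Rlt_le_trans _ _ _ Hy1 A1).
    + replace (snd y + t * snd a - (snd x + t * snd a)) with (snd y - snd x) by ring.
      exact (Rlt_le_trans _ _ _ Hy2 A1).
  - replace ((N - 0) * (eps / (2 * N))) with (eps / 2) by (field; lra).
    assert (H := cond_pos eps). lra.
Qed.

Lemma Xray_minus r k a h h' x :
  fst a <> 0 -> everywhere_continuous h -> strip_supported r h ->
  everywhere_continuous h' -> strip_supported r h' ->
  Xray k a (fun y => h y - h' y) x = Xray k a h x - Xray k a h' x.
Proof.
  intros Ha Hc Hs Hc' Hs'.
  set (N := (r + Rabs (fst x)) / Rabs (fst a)).
  assert (H0 : forall t, N <= t -> h (along x a t) = 0)
    by (intros; now apply Hs, leaves_strip).
  assert (H0' : forall t, N <= t -> h' (along x a t) = 0)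
    by (intros; now apply Hs', leaves_strip).
  assert (G := is_RInt_gen_Xray k a h x 0 N Hc H0).
  assert (G' := is_RInt_gen_Xray k a h' x 0 N Hc' H0').
  rewrite <- (along_0 x a).
  unfold Xray at 2 3.
  change (Xray k a (fun y => h y - h' y) (along x a 0) =
   RInt_gen (fun t => h (along (along x a 0) a t) * t ^ k) (at_point 0) (Rbar_locally p_infty) -
   RInt_gen (fun t => h' (along (along x a 0) a t) * t ^ k) (at_point 0) (Rbar_locally p_infty)).
  rewrite (is_RInt_gen_unique _ _ G), (is_RInt_gen_unique _ _ G').
  unfold Xray. apply is_RInt_gen_unique.
  apply (is_RInt_gen_ext (fun t => minus (h (along (along x a 0) a t) * t ^ k)
                                    (h' (along (along x a 0) a t) * t ^ k))).
  - apply filter_forall. intros ab t _. unfold minus, plus, opp; simpl.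
    unfold along; simpl. ring.
  - now apply (is_RInt_gen_minus (fun t => h (along (along x a 0) a t) * t ^ k)).
Qed.

(** * Functions with equal derivatives in two directions *)

(** A step t (u - v) is the step t u followed by -t v.  By the mean value
    theorem W changes by -t A(p) on the first and by t A(q) on the second, with
    p and q within O(t) of the starting point, so continuity of A makes the
    total change o(t). *)
Lemma constant_on_lines W A u v x s :
  everywhere_continuous A ->
  (forall y t, is_derive (fun t => W (along y u t)) t (- A (along y u t))) ->
  (forall y t, is_derive (fun t => W (along y v t)) t (- A (along y v t))) ->
  W (along x (fst u - fst v, snd u - snd v) s) = W x.
Proof.
  intros Hc Hu Hv.
  set (w := (fst u - fst v, snd u - snd v)).
  assert (MV : forall a, (forall y t, is_derive (fun t => W (along y a t)) t (- A (along y a t))) ->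
     forall y t, exists c, Rabs c <= Rabs t /\ W (along y a t) - W y = - A (along y a c) * t).
  { intros a Ha y t.
    destruct (MVT_gen (fun t => W (along y a t)) 0 t (fun c => - A (along y a c))) as [c [H1 H2]].
    - intros; apply Ha.
    - intros c _. apply derivable_continuous_pt. exists (- A (along y a c)).
      apply is_derive_Reals, Ha.
    - exists c. split.
      + unfold Rmin, Rmax in H1. destruct (Rle_dec 0 t); split_Rabs; lra.
      + rewrite along_0, Rminus_0_r in H2. exact H2. }
  assert (D0 : forall y, is_derive (fun t => W (along y w t)) 0 0).
  { intros y. apply is_derive_Reals. intros e He.
    assert (He2 : 0 < e / 2) by lra.
    destruct (proj1 (filterlim_locally (U := R_UniformSpace) (F := locally (y : R * R)) A (A y))
                (Hc y) (mkposreal _ He2)) as [d Hd].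
    (* K bounds every coordinate of u, v and u - v; the factor 2 in d / (2 K)
       accounts for the two steps. *)
    set (K := Rabs (fst u) + Rabs (snd u) + Rabs (fst v) + Rabs (snd v) + 1).
    assert (P1 := Rabs_pos (fst u)). assert (P2 := Rabs_pos (snd u)).
    assert (P3 := Rabs_pos (fst v)). assert (P4 := Rabs_pos (snd v)).
    assert (HK : 0 < d / (2 * K)) by (apply Rdiv_lt_0_compat; [apply cond_pos|unfold K; lra]).
    exists (mkposreal _ HK). intros t Ht0 Ht. simpl in Ht.
    assert (HtK : Rabs t * (2 * K) < d).
    { apply (Rmult_lt_compat_r (2 * K)) in Ht; [|unfold K; lra].
      replace (d / (2 * K) * (2 * K)) with (pos d) in Ht by (field; unfold K; lra). exact Ht. }
    assert (Hb : forall c a b, Rabs c <= Rabs t -> Rabs a <= K -> Rabs b <= K ->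
                 Rabs (t * a + c * b) < d).
    { intros c a b H1 H2 H3. apply Rle_lt_trans with (2 := HtK).
      apply Rle_trans with (1 := Rabs_triang _ _). rewrite !Rabs_mult.
      assert (Rabs t * Rabs a <= Rabs t * K) by (apply Rmult_le_compat_l; [apply Rabs_pos|easy]).
      assert (Rabs c * Rabs b <= Rabs t * K) by (apply Rmult_le_compat; auto using Rabs_pos).
      lra. }
    (* Both segments run forward, from y and from y + t (u - v), and they end
       at the same corner y + t u. *)
    destruct (MV u Hu y t) as [c1 [C1 E1]].
    destruct (MV v Hv (along y w t) t) as [c2 [C2 E2]].
    assert (E : along (along y w t) v t = along y u t)
      by (unfold along, w; simpl; f_equal; ring).
    rewrite E in E2.
    rewrite Rplus_0_l, along_0.
    assert (B1 : Rabs (A (along y u c1) - A y) < e / 2).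
    { apply (Hd (along y u c1)). split.
      - change (Rabs (fst y + c1 * fst u - fst y) < d).
        replace (fst y + c1 * fst u - fst y) with (t * 0 + c1 * fst u) by ring.
        apply Hb; [easy|rewrite Rabs_R0|]; unfold K; lra.
      - change (Rabs (snd y + c1 * snd u - snd y) < d).
        replace (snd y + c1 * snd u - snd y) with (t * 0 + c1 * snd u) by ring.
        apply Hb; [easy|rewrite Rabs_R0|]; unfold K; lra. }
    assert (B2 : Rabs (A (along (along y w t) v c2) - A y) < e / 2).
    { assert (T1 := Rabs_triang (fst u) (- fst v)). assert (T2 := Rabs_triang (snd u) (- snd v)).
      rewrite !Rabs_Ropp in T1, T2.
      apply (Hd (along (along y w t) v c2)). split.
      - change (Rabs (fst y + t * (fst u - fst v) + c2 * fst v - fst y) < d).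
        replace (fst y + t * (fst u - fst v) + c2 * fst v - fst y)
          with (t * (fst u + - fst v) + c2 * fst v) by ring.
        apply Hb; [easy| |]; unfold K; lra.
      - change (Rabs (snd y + t * (snd u - snd v) + c2 * snd v - snd y) < d).
        replace (snd y + t * (snd u - snd v) + c2 * snd v - snd y)
          with (t * (snd u + - snd v) + c2 * snd v) by ring.
        apply Hb; [easy| |]; unfold K; lra. }
    replace ((W (along y w t) - W y) / t - 0)
      with ((A (along (along y w t) v c2) - A y) - (A (along y u c1) - A y)).
    2: { replace (W (along y w t) - W y)
           with ((W (along y u t) - W y) - (W (along y u t) - W (along y w t))) by ring.
         rewrite E1, E2. field. exact Ht0. }
    apply Rle_lt_trans with (1 := Rabs_triang _ _). rewrite Rabs_Ropp. lra. }
  assert (D : forall t, is_derive (fun t => W (along x w t)) t 0).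
  { intros t.
    apply (is_derive_ext (fun c => W (along (along x w t) w (c - t)))).
    { intros c. rewrite along_add. now rewrite (Rplus_minus t c). }
    evar_last.
    - apply (is_derive_comp (fun c => W (along (along x w t) w c)) (fun c => c - t)).
      + rewrite Rminus_diag. apply D0.
      + auto_derive; easy.
    - unfold scal; simpl; unfold mult; simpl. ring. }
  rewrite <- (along_0 x w) at 2.
  destruct (MVT_gen (fun t => W (along x w t)) 0 s (fun _ => 0)) as [c [_ H]].
  - intros; apply D.
  - intros c _. apply derivable_continuous_pt. exists 0. apply is_derive_Reals, D.
  - simpl in H. lra.
Qed.

(** * Injectivity for mirrored directions *)

Lemma is_derive_Xray0 r a h :
  fst a <> 0 -> everywhere_continuous h -> strip_supported r h ->
  forall x s, is_derive (fun s => Xray 0 a h (along x a s)) s (- h (along x a s)).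
Proof.
  intros Ha Hc Hs x s.
  apply (is_derive_Xray0_along _ _ _ _ ((r + Rabs (fst x)) / Rabs (fst a)) Hc).
  intros; now apply Hs, leaves_strip.
Qed.

Lemma is_derive_Xray1 r a h :
  fst a <> 0 -> everywhere_continuous h -> strip_supported r h ->
  forall x s, is_derive (fun s => Xray 1 a h (along x a s)) s (- Xray 0 a h (along x a s)).
Proof.
  intros Ha Hc Hs x s.
  apply (is_derive_Xray1_along _ _ _ _ ((r + Rabs (fst x)) / Rabs (fst a)) Hc).
  intros; now apply Hs, leaves_strip.
Qed.

(** A point outside the strip on the side towards which a points only moves
    further away from the strip along its ray. *)
Lemma Xray_past_strip r k a h x :
  everywhere_continuous h -> strip_supported r h ->
  r <= Rabs (fst x) -> 0 < fst a * fst x -> Xray k a h x = 0.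
Proof.
  intros Hc Hs Hr Hax. rewrite <- (along_0 x a).
  rewrite (Xray_along k a h x 0 0 Hc); [exact (RInt_point 0 (fun t => h (along x a t) * (t - 0) ^ k))|].
  intros t Ht. apply Hs. simpl. apply Rle_trans with (1 := Hr).
  apply Rsqr_le_abs_0. unfold Rsqr.
  assert (0 <= t * (fst a * fst x)) by (apply Rmult_le_pos; lra).
  assert (0 <= (t * fst a) * (t * fst a)) by apply Rle_0_sqr.
  lra.
Qed.

Lemma derivative_of_vanishing W A a :
  (forall x, W x = 0) ->
  (forall x t, is_derive (fun t => W (along x a t)) t (- A (along x a t))) ->
  forall x, A x = 0.
Proof.
  intros HW HA x.
  assert (H := HA x 0). rewrite along_0 in H.
  apply (is_derive_ext _ (fun _ => 0)) in H; [|intros; apply HW].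
  apply is_derive_unique in H. rewrite Derive_const in H. lra.
Qed.

(** The difference u - v is horizontal, so every horizontal line carries a single
    value of W, which is read off where it crosses the line x_1 = p. *)
Lemma vanishes_along_mirrored_directions W A u v p :
  fst u <> 0 -> v = (- fst u, snd u) -> everywhere_continuous A ->
  (forall x t, is_derive (fun t => W (along x u t)) t (- A (along x u t))) ->
  (forall x t, is_derive (fun t => W (along x v t)) t (- A (along x v t))) ->
  (forall x, fst x = p -> W x = 0) ->
  forall x, W x = 0.
Proof.
  intros Hu -> Hc HWu HWv Hp x.
  rewrite <- (constant_on_lines W A u (- fst u, snd u) x ((p - fst x) / (2 * fst u)) Hc HWu HWv).
  apply Hp. simpl. field. exact Hu.
Qed.

Lemma exit_side r c : 0 < r -> c <> 0 -> exists p, r <= Rabs p /\ 0 < c * p.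
Proof.
  intros Hr Hc.
  destruct (Rdichotomy _ _ Hc) as [H|H].
  - exists (- r). rewrite Rabs_Ropp, Rabs_pos_eq by lra. split; [lra|].
    rewrite <- Rmult_opp_opp, Ropp_involutive. apply Rmult_lt_0_compat; lra.
  - exists r. rewrite Rabs_pos_eq by lra. split; [lra|]. apply Rmult_lt_0_compat; lra.
Qed.

(** The two hypotheses present W = X^1_u F and A = X_u F as transforms along v as
    well, so that W has derivative -A in both directions. *)
Lemma vline_moments_injective r u v F G :
  0 < r -> fst u <> 0 -> v = (- fst u, snd u) ->
  everywhere_continuous F -> strip_supported r F ->
  everywhere_continuous G -> strip_supported r G ->
  (forall x, Xray 0 u F x + Xray 0 v G x = 0) ->
  (forall x, Xray 1 u F x + Xray 1 v G x = 0) ->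
  forall x, F x = 0 /\ G x = 0.
Proof.
  intros Hr Hu Hv HcF HsF HcG HsG H0 H1.
  assert (Hv1 : fst v <> 0) by (rewrite Hv; simpl; lra).
  destruct (exit_side r (fst u) Hr Hu) as [p [Hp1 Hp2]].
  assert (W0 : forall x, Xray 1 u F x = 0).
  { apply (vanishes_along_mirrored_directions _ (Xray 0 u F) u v p Hu Hv).
    - now apply everywhere_continuous_Xray0 with r.
    - now apply is_derive_Xray1 with r.
    - intros x t.
      apply (is_derive_ext (fun t => - Xray 1 v G (along x v t))).
      { intros c. specialize (H1 (along x v c)). lra. }
      replace (- Xray 0 u F (along x v t)) with (- - Xray 0 v G (along x v t))
        by (specialize (H0 (along x v t)); lra).
      apply (is_derive_opp (fun t => Xray 1 v G (along x v t))).
      now apply is_derive_Xray1 with r.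
    - intros x Hx. apply Xray_past_strip with r; try easy; now rewrite Hx. }
  assert (A0 : forall x, Xray 0 u F x = 0).
  { apply (derivative_of_vanishing _ _ u W0). now apply is_derive_Xray1 with r. }
  assert (B0 : forall x, Xray 0 v G x = 0)
    by (intros x; specialize (H0 x); rewrite A0 in H0; lra).
  intros x. split.
  - apply (derivative_of_vanishing _ _ u A0). now apply is_derive_Xray0 with r.
  - apply (derivative_of_vanishing _ _ v B0). now apply is_derive_Xray0 with r.
Qed.

(** With Q = -P the function W = X_u P = -X_v Q has derivative -P along both
    directions; here P itself plays the part of A, so no moment is needed. *)
Lemma signed_vline_injective r u v P Q :
  0 < r -> fst u <> 0 -> v = (- fst u, snd u) ->
  everywhere_continuous P -> strip_supported r P ->
  everywhere_continuous Q -> strip_supported r Q ->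
  (forall x, Q x = - P x) ->
  (forall x, Xray 0 u P x + Xray 0 v Q x = 0) ->
  forall x, P x = 0.
Proof.
  intros Hr Hu Hv HcP HsP HcQ HsQ HPQ H0.
  assert (Hv1 : fst v <> 0) by (rewrite Hv; simpl; lra).
  destruct (exit_side r (fst u) Hr Hu) as [p [Hp1 Hp2]].
  assert (W0 : forall x, Xray 0 u P x = 0).
  { apply (vanishes_along_mirrored_directions _ P u v p Hu Hv HcP).
    - now apply is_derive_Xray0 with r.
    - intros x t.
      apply (is_derive_ext (fun t => - Xray 0 v Q (along x v t))).
      { intros c. specialize (H0 (along x v c)). lra. }
      rewrite <- HPQ, <- (Ropp_involutive (Q (along x v t))).
      apply (is_derive_opp (fun t => Xray 0 v Q (along x v t))).
      now apply is_derive_Xray0 with r.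
    - intros x Hx. apply Xray_past_strip with r; try easy; now rewrite Hx. }
  apply (derivative_of_vanishing _ _ u W0). now apply is_derive_Xray0 with r.
Qed.

(** * Components of the tensor field *)

Lemma Cc2_continuous_strip r h : Cc2 r h -> everywhere_continuous h /\ strip_supported r h.
Proof.
  intros [Hd [_ Hs]]. split.
  - apply everywhere_continuous_pt. intros p q. apply (Hd p q).
  - intros x Hx. destruct (Req_dec (h x) 0) as [H|H]; [easy|exfalso].
    assert (Hd' : Defs.disc r x).
    { apply Hs. intros e. exists x. split; [apply ball_center|easy]. }
    apply (Rlt_not_le _ _ Hd'), Rle_trans with (1 := Hx). unfold enorm.
    rewrite <- sqrt_Rsqr_abs. apply sqrt_le_1_alt. unfold Rsqr.
    assert (H2 := pow2_ge_0 (snd x)). lra.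
Qed.

Lemma tdot_continuous_strip r f T :
  Cc2_sym r f ->
  everywhere_continuous (fun x => tdot (f x) T) /\ strip_supported r (fun x => tdot (f x) T).
Proof.
  intros [_ [H11 [H12 [_ H22]]]].
  apply Cc2_continuous_strip in H11, H12, H22.
  destruct H11 as [C11 S11], H12 as [C12 S12], H22 as [C22 S22].
  split.
  - intros x. unfold tdot.
    apply (continuous_plus (fun x : R * R => c11 (f x) * c11 T + 2 * (c12 (f x) * c12 T))
             (fun x => c22 (f x) * c22 T)).
    + apply (continuous_plus (fun x : R * R => c11 (f x) * c11 T)
               (fun x => 2 * (c12 (f x) * c12 T))).
      * apply (continuous_mult (fun x : R * R => c11 (f x)) (fun _ => c11 T));
          [apply C11|apply continuous_const].
      * apply (continuous_mult (fun _ : R * R => 2) (fun x => c12 (f x) * c12 T));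
          [apply continuous_const|].
        apply (continuous_mult (fun x : R * R => c12 (f x)) (fun _ => c12 T));
          [apply C12|apply continuous_const].
    + apply (continuous_mult (fun x : R * R => c22 (f x)) (fun _ => c22 T));
        [apply C22|apply continuous_const].
  - intros x Hx. unfold tdot. rewrite (S11 x), (S12 x), (S22 x) by easy. ring.
Qed.

Definition tminus (s t : tensor2) : tensor2 :=
  Tensor2 (c11 s - c11 t) (c12 s - c12 t) (c21 s - c21 t) (c22 s - c22 t).

Lemma tdot_tminus s t T : tdot (tminus s t) T = tdot s T - tdot t T.
Proof. unfold tdot; simpl; ring. Qed.

Lemma tdot_tminus_continuous_strip r f g T :
  Cc2_sym r f -> Cc2_sym r g ->
  everywhere_continuous (fun x => tdot (tminus (f x) (g x)) T) /\
  strip_supported r (fun x => tdot (tminus (f x) (g x)) T).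
Proof.
  intros Hf Hg.
  destruct (tdot_continuous_strip r f T Hf) as [Cf Sf].
  destruct (tdot_continuous_strip r g T Hg) as [Cg Sg].
  split.
  - intros x.
    apply (continuous_ext (fun y : R * R => tdot (f y) T - tdot (g y) T)).
    + intros y. symmetry. apply tdot_tminus.
    + apply (continuous_minus (fun y : R * R => tdot (f y) T)); [apply Cf|apply Cg].
  - intros x Hx. rewrite tdot_tminus, (Sf x Hx), (Sg x Hx). ring.
Qed.

Lemma Xray_tdot_tminus r k a T f g x :
  fst a <> 0 -> Cc2_sym r f -> Cc2_sym r g ->
  Xray k a (fun y => tdot (tminus (f y) (g y)) T) x =
  Xray k a (fun y => tdot (f y) T) x - Xray k a (fun y => tdot (g y) T) x.
Proof.
  intros Ha Hf Hg.
  destruct (tdot_continuous_strip r f T Hf) as [Cf Sf].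
  destruct (tdot_continuous_strip r g T Hg) as [Cg Sg].
  rewrite <- (Xray_minus r) by easy.
  f_equal. apply functional_extensionality; intros y. apply tdot_tminus.
Qed.

Lemma lin_indep_mirrored u : lin_indep u (- fst u, snd u) -> fst u <> 0 /\ snd u <> 0.
Proof.
  intros H. split; intros H0.
  - destruct (H 1 (-1)); simpl; rewrite ?H0; lra.
  - destruct (H 1 1); simpl; rewrite ?H0; lra.
Qed.

(** Reflecting u_1 flips only the sign of the mixed term, so the difference and
    the sum of the two equations separate it from the diagonal part. *)
Lemma tdot_mirrored_zero u s :
  fst u <> 0 -> snd u <> 0 ->
  tdot s (odot u u) = 0 -> tdot s (odot (- fst u, snd u) (- fst u, snd u)) = 0 ->
  c12 s = 0 /\ c11 s * fst u ^ 2 + c22 s * snd u ^ 2 = 0.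
Proof.
  intros H1 H2. unfold tdot; simpl. intros E1 E2.
  assert (H : fst u * snd u <> 0) by now apply Rmult_integral_contrapositive.
  split; [|lra].
  apply (Rmult_eq_reg_r (fst u * snd u)); [|easy]. lra.
Qed.

Lemma tdot_odot_perp u s :
  c12 s = 0 -> tdot s (odot u (perp u)) = (c22 s - c11 s) * (fst u * snd u).
Proof. intros E. unfold tdot. rewrite E. simpl. field. Qed.

Theorem theorem9 (r1 : R) (u v : vec) (f g : vec -> tensor2)
  (hr1 : 0 < r1)
  (hu : enorm u = 1)
  (hv : v = (- fst u, snd u))
  (huv : lin_indep u v)
  (hf : Cc2_sym r1 f) (hg : Cc2_sym r1 g)
  (hL : forall x : vec, Ltrans u v f x = Ltrans u v g x)
  (hL1 : forall x : vec, L1trans u v f x = L1trans u v g x)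
  (hM : forall x : vec, Mtrans u v f x = Mtrans u v g x) :
  f = g.
Proof.
  assert (Hnz : fst u <> 0 /\ snd u <> 0) by (apply lin_indep_mirrored; now rewrite <- hv).
  destruct Hnz as [Hu1 Hu2].
  assert (Hv1 : fst v <> 0) by (rewrite hv; simpl; lra).
  set (h := fun x => tminus (f x) (g x)).
  assert (Hlin : forall k a T x, fst a <> 0 ->
     Xray k a (fun y => tdot (h y) T) x =
     Xray k a (fun y => tdot (f y) T) x - Xray k a (fun y => tdot (g y) T) x)
    by (intros; now apply Xray_tdot_tminus with r1).
  assert (Hreg : forall T, everywhere_continuous (fun x => tdot (h x) T) /\
                           strip_supported r1 (fun x => tdot (h x) T))
    by (intros; now apply tdot_tminus_continuous_strip).
  assert (HLM : forall x, tdot (h x) (odot u u) = 0 /\ tdot (h x) (odot v v) = 0).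
  { apply (vline_moments_injective r1 u v _ _ hr1 Hu1 hv); try apply Hreg.
    - intros x. rewrite !Hlin by easy. generalize (hL x). unfold Ltrans, Lmom. lra.
    - intros x. rewrite !Hlin by easy. generalize (hL1 x). unfold L1trans, Lmom. lra. }
  assert (Hh : forall x, c12 (h x) = 0 /\ c11 (h x) * fst u ^ 2 + c22 (h x) * snd u ^ 2 = 0).
  { intros x. destruct (HLM x) as [E1 E2]. rewrite hv in E2. now apply tdot_mirrored_zero. }
  assert (HP : forall x, tdot (h x) (odot u (perp u)) = 0).
  { apply (signed_vline_injective r1 u v
             _ (fun x => tdot (h x) (odot v (perp v))) hr1 Hu1 hv); try apply Hreg.
    - intros x. destruct (Hh x) as [E _]. unfold tdot. rewrite E, hv. simpl. field.
    - intros x. rewrite !Hlin by easy. generalize (hM x). unfold Mtrans. lra. }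
  assert (Hn : fst u ^ 2 + snd u ^ 2 = 1).
  { rewrite <- (pow2_sqrt (fst u ^ 2 + snd u ^ 2)).
    - change (enorm u ^ 2 = 1). rewrite hu. ring.
    - generalize (pow2_ge_0 (fst u)) (pow2_ge_0 (snd u)). lra. }
  apply functional_extensionality. intros x.
  destruct (Hh x) as [E12 E]. specialize (HP x). rewrite tdot_odot_perp in HP by easy.
  assert (Ed : c11 (h x) = c22 (h x)).
  { apply (Rmult_eq_reg_r (fst u * snd u)); [lra|].
    now apply Rmult_integral_contrapositive. }
  assert (E11 : c11 (h x) = 0).
  { rewrite <- Ed, <- Rmult_plus_distr_l, Hn in E. lra. }
  rewrite E11 in Ed.
  assert (Sf := proj1 hf x). assert (Sg := proj1 hg x).
  unfold h in *. destruct (f x), (g x). simpl in *. f_equal; lra.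
Qed.
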